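(* Let $\Omega=[a,b]$ and let $(\varepsilon_w,p_w,\varepsilon_\phi,p_\phi,\varepsilon_{w,\phi})$ be a sufficiently smooth solution of the explicit Timoshenko port-Hamiltonian system $$\begin{bmatrix} \partial_t\varepsilon_w \\ \partial_tp_w \\ \partial_t\varepsilon_\phi \\ \partial_tp_\phi \\ \partial_t\varepsilon_{w,\phi} \end{bmatrix}=\begin{bmatrix} 0&\partial_x&0&0&0 \\ \partial_x&0&0&0&\partial_x \\ 0&0&0&\partial_x&0 \\ 0&0&\partial_x&0&\mathrm{Id} \\ 0&\partial_x&0&-\mathrm{Id}&0 \end{bmatrix}\begin{bmatrix} \sigma_w \\ v \\ \sigma_\phi \\ \omega \\ N \end{bmatrix}$$ with constitutive relations $$v=\frac{p_w}{\rho A},\quad \sigma_w=T_0\varepsilon_w,\quad \omega=\frac{p_\phi}{\rho I},\quad \sigma_\phi=EI\,\varepsilon_\phi,\quad N=A\kappa G\,\varepsilon_{w,\phi}$$ and Hamiltonian $$\mathcal{H}^E=\frac12\int_\Omega\Big(\frac{p_w^2}{\rho A}+T_0\varepsilon_w^2+\frac{p_\phi^2}{\rho I}+EI\,\varepsilon_\phi^2+A\kappa G\,\varepsilon_{w,\phi}^2\Big)dx.$$ Then the power balance reads $$\frac{d}{dt}\mathcal{H}^E=\big[v\,\sigma_w+v\,N+\omega\,\sigma_\phi\big]_a^b.$$ Thus, with the power boundary port variables $f_\partial=\mathrm{tr}([v\ \ v\ \ \omega]^\top)$ and $e_\partial=\mathrm{tr}([\sigma_w\ \ N\ \ \sigma_\phi]^\top)$,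 one has $\frac{d}{dt}\mathcal{H}^E=[f_\partial\cdot e_\partial]_a^b$.
   Context: $\rho,A,T_0,\kappa,G,I,E$ are positive time-independent physical parameters (mass density, cross-section area, tension, shear coefficient, shear modulus, moment of inertia, Young's modulus). $p_w$ and $p_\phi$ are the linear and angular momenta, $\varepsilon_w=\partial_xw$, $\varepsilon_\phi=\partial_x\phi$, $\varepsilon_{w,\phi}=\partial_xw-\phi$, where $w$ is the transverse displacement and $\phi$ the shear angle. $\mathrm{tr}$ is the Dirichlet trace (boundary values at $a$ and $b$), and $[g]_a^b:=g(b)-g(a)$. *)

(* Defs.v *)
From Stdlib Require Import Reals List.
From Coquelicot Require Import Coquelicot.
Import ListNotations.
Open Scope R_scope.

(** * Derivatives relative to a subset of the line

    For [D] the whole line this is [is_derive]; at an end point of an interval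
    [D] it is the one-sided derivative, so nothing is assumed about values
    outside [D]. *)

Definition is_derive_on (D : R -> Prop) (f : R -> R) (x l : R) : Prop :=
  filterdiff f (within D (locally x)) (fun y => scal y l).

Definition ex_derive_on (D : R -> Prop) (f : R -> R) (x : R) : Prop :=
  exists l, is_derive_on D f x l.

(** Meaningful when the derivative exists and [x] is not isolated in [D]. *)
Definition Derive_on (D : R -> Prop) (f : R -> R) (x : R) : R :=
  iota (is_derive_on D f x).

(** Any interval (open, closed, half-open, bounded or not) containing at least
    two points. *)
Definition proper_interval (J : R -> Prop) : Prop :=
  (forall r s t, J r -> J t -> r <= s <= t -> J s) /\
  (exists s t, J s /\ J t /\ s < t).

(** * Fields on a space-time domain [J * [a, b]], as functions of time [t] and
    position [x], in this order *)

Definition field := R -> R -> R.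

Definition seg (a b : R) (x : R) : Prop := a <= x <= b.

Definition dt (J : R -> Prop) (u : field) : field :=
  fun t x => Derive_on J (fun s => u s x) t.

Definition dx (a b : R) (u : field) : field :=
  fun t x => Derive_on (seg a b) (u t) x.

Definition jointly_continuous (J : R -> Prop) (a b : R) (u : field) : Prop :=
  continuous_on (fun p : R * R => J (fst p) /\ seg a b (snd p))
                (fun p : R * R => u (fst p) (snd p)).

Definition C1_time (J : R -> Prop) (a b : R) (u : field) : Prop :=
  jointly_continuous J a b u /\
  (forall t x, J t -> seg a b x -> ex_derive_on J (fun s => u s x) t) /\
  jointly_continuous J a b (dt J u).

Definition C1_space (J : R -> Prop) (a b : R) (u : field) : Prop :=
  jointly_continuous J a b u /\
  (forall t x, J t -> seg a b x -> ex_derive_on (seg a b) (u t) x) /\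
  jointly_continuous J a b (dx a b u).

(** * The Timoshenko beam *)

(** The parameters do not depend on time; they may depend on the position. *)
Record beam := Beam {
  rho : R -> R;      (* mass density *)
  area : R -> R;     (* cross-section area, A *)
  tension : R -> R;  (* tension, T_0 *)
  kappa : R -> R;    (* shear coefficient *)
  shear : R -> R;    (* shear modulus, G *)
  inertia : R -> R;  (* moment of inertia, I *)
  young : R -> R     (* Young's modulus, E *)
}.

Definition positive_parameters (a b : R) (P : beam) : Prop :=
  forall x, seg a b x ->
    0 < rho P x /\ 0 < area P x /\ 0 < tension P x /\ 0 < kappa P x /\
    0 < shear P x /\ 0 < inertia P x /\ 0 < young P x.

Record state := State {
  eps_w : field;
  p_w : field;
  eps_phi : field;
  p_phi : field;
  eps_wphi : field
}.

Definition v (P : beam) (z : state) : field :=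
  fun t x => p_w z t x / (rho P x * area P x).
Definition sigma_w (P : beam) (z : state) : field :=
  fun t x => tension P x * eps_w z t x.
Definition omega (P : beam) (z : state) : field :=
  fun t x => p_phi z t x / (rho P x * inertia P x).
Definition sigma_phi (P : beam) (z : state) : field :=
  fun t x => young P x * inertia P x * eps_phi z t x.
Definition shear_force (P : beam) (z : state) : field :=
  fun t x => area P x * kappa P x * shear P x * eps_wphi z t x.

Definition energy_variables (z : state) : list field :=
  [eps_w z; p_w z; eps_phi z; p_phi z; eps_wphi z].

Definition coenergy_variables (P : beam) (z : state) : list field :=
  [sigma_w P z; v P z; sigma_phi P z; omega P z; shear_force P z].

(** ** Matrices of operators, given by their rows *)

Definition operator := field -> field.

Definition op0 : operator := fun _ _ _ => 0.
Definition Id : operator := fun u => u.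
Definition opp_op (L : operator) : operator := fun u t x => - L u t x.

Definition row_apply (r : list operator) (e : list field) : field :=
  fun t x =>
    fold_right Rplus 0 (map (fun q => fst q (snd q) t x) (combine r e)).

Definition matrix_apply (M : list (list operator)) (e : list field)
  : list field :=
  map (fun r => row_apply r e) M.

Definition timoshenko_operator (a b : R) : list (list operator) :=
  let D := dx a b in
  [ [op0; D;   op0; op0;       op0];
    [D;   op0; op0; op0;       D  ];
    [op0; op0; op0; D;         op0];
    [op0; op0; D;   op0;       Id ];
    [op0; D;   op0; opp_op Id; op0] ].

Definition values (us : list field) (t x : R) : list R :=
  map (fun u => u t x) us.

Definition timoshenko_system (J : R -> Prop) (a b : R) (P : beam)
  (z : state) : Prop :=
  forall t x, J t -> seg a b x ->
    values (map (dt J) (energy_variables z)) t x =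
    values (matrix_apply (timoshenko_operator a b) (coenergy_variables P z))
           t x.

(** Classical regularity: only the derivatives that occur in the system are
    required to exist and to be continuous up to the boundary.  With constant
    parameters this holds as soon as the energy variables are C^1 in (t, x). *)
Definition sufficiently_smooth (J : R -> Prop) (a b : R) (P : beam)
  (z : state) : Prop :=
  List.Forall (C1_time J a b) (energy_variables z) /\
  List.Forall (C1_space J a b) (coenergy_variables P z).

Definition Hamiltonian (a b : R) (P : beam) (z : state) (t : R) : R :=
  / 2 * RInt (fun x =>
      p_w z t x ^ 2 / (rho P x * area P x)
    + tension P x * eps_w z t x ^ 2
    + p_phi z t x ^ 2 / (rho P x * inertia P x)
    + young P x * inertia P x * eps_phi z t x ^ 2
    + area P x * kappa P x * shear P x * eps_wphi z t x ^ 2) a b.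

(** ** Boundary values *)

Inductive endpoint := left_end | right_end.

(** Dirichlet trace: restriction of a function on [[a, b]] to its boundary. *)
Definition tr {V : Type} (a b : R) (g : R -> V) : endpoint -> V :=
  fun s => match s with left_end => g a | right_end => g b end.

(** [[g]_a^b], for [g] defined on the boundary. *)
Definition bracket (g : endpoint -> R) : R := g right_end - g left_end.

Definition dot (x y : list R) : R :=
  fold_right Rplus 0 (map (fun q => fst q * snd q) (combine x y)).

Definition f_boundary (a b : R) (P : beam) (z : state) (t : R)
  : endpoint -> list R :=
  tr a b (values [v P z; v P z; omega P z] t).

Definition e_boundary (a b : R) (P : beam) (z : state) (t : R)
  : endpoint -> list R :=
  tr a b (values [sigma_w P z; shear_force P z; sigma_phi P z] t).

(* Main.v *)
(** The energy density is half the sum of the products of the energy variables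
    with their co-energy variables, and each pair is proportional with a
    time-independent factor. Hence [dH/dt] is the integral of the sum of the
    co-energy variables times the time derivatives of the energy variables. By
    the system this integrand is the [x]-derivative of
    [v sigma_w + v N + omega sigma_phi]: the zeroth-order terms [omega N] and
    [- N omega] cancel, and what remains is the product rule.

    Derivatives are one-sided on the boundary of the space-time domain. They
    are used only in the interior, where they are the usual ones; continuity up
    to the boundary takes care of the rest. *)

Require Import Defs.
From Stdlib Require Import Reals List.
From Stdlib Require Import Lra ClassicalEpsilon.
From Coquelicot Require Import Coquelicot.
Open Scope R_scope.

(** * Calculus relative to an interval *)

(** The nearest-point projection onto the segment. Composing with it extends a function given on the
    segment to the whole line, where the classical theorems apply. *)
Definition clamp (a b x : R) : R := Rmax a (Rmin b x).

Lemma seg_clamp (a b x : R) : a <= b -> seg a b (clamp a b x).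
Proof.
  intros hab; unfold seg, clamp.
  split; [apply Rmax_l|].
  apply Rmax_lub; [exact hab | apply Rmin_l].
Qed.

Lemma clamp_id (a b x : R) : seg a b x -> clamp a b x = x.
Proof.
  intros [h1 h2]; unfold clamp.
  rewrite (Rmin_right b x h2); now apply Rmax_right.
Qed.

Lemma clamp_lipschitz (a b x y : R) :
  Rabs (clamp a b x - clamp a b y) <= Rabs (x - y).
Proof.
  unfold clamp, Rmax, Rmin.
  destruct (Rle_dec b x), (Rle_dec b y); repeat destruct Rle_dec;
    unfold Rabs; repeat destruct Rcase_abs; lra.
Qed.

Lemma continuous_comp_clamp (a b : R) (f : R -> R) (x : R) :
  a <= b -> continuous_on (seg a b) f ->
  continuous (fun y => f (clamp a b y)) x.
Proof.
  intros hab hf P hP.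
  destruct (hf (clamp a b x) (seg_clamp a b x hab) P hP) as [d hd].
  exists d; intros y hy.
  apply hd; [| now apply seg_clamp].
  eapply Rle_lt_trans; [apply clamp_lipschitz | exact hy].
Qed.

Lemma ex_RInt_continuous_on (a b : R) (f : R -> R) :
  a <= b -> continuous_on (seg a b) f -> ex_RInt f a b.
Proof.
  intros hab hf.
  apply ex_RInt_ext with (fun y => f (clamp a b y)).
  - intros x; rewrite Rmin_left, Rmax_right by exact hab; intros hx.
    rewrite clamp_id; [reflexivity | unfold seg; lra].
  - apply (ex_RInt_continuous (V := R_CompleteNormedModule)).
    intros x _; now apply continuous_comp_clamp.
Qed.

Lemma locally_interior (a b x : R) :
  a < x < b -> locally x (fun y => a < y < b).
Proof.
  intros [h1 h2].
  assert (hd : 0 < Rmin (x - a) (b - x)) by (apply Rmin_pos; lra).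
  exists (mkposreal _ hd); intros y hy.
  apply Rabs_lt_between' in hy; simpl in hy.
  pose proof (Rmin_l (x - a) (b - x)); pose proof (Rmin_r (x - a) (b - x)).
  lra.
Qed.

(** The clamped function is continuous everywhere and coincides with [f] near each interior point,
    so the usual mean value theorem applies to it. *)
Lemma MVT_seg (a b : R) (f df : R -> R) :
  a < b -> continuous_on (seg a b) f ->
  (forall x, a < x < b -> is_derive f x (df x)) ->
  exists c, seg a b c /\ f b - f a = df c * (b - a).
Proof.
  intros hab hf hd.
  destruct (MVT_gen (fun y => f (clamp a b y)) a b df) as [c [hc he]];
    rewrite ?Rmin_left, ?Rmax_right in * by lra.
  - intros x hx.
    apply is_derive_ext_loc with f; [| now apply hd].
    apply filter_imp with (2 := locally_interior a b x hx).
    intros y hy; rewrite clamp_id; [reflexivity | unfold seg; lra].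
  - intros x _; apply continuity_pt_filterlim.
    apply continuous_comp_clamp; [lra | exact hf].
  - exists c; split; [exact hc|].
    rewrite !clamp_id in he by (unfold seg; lra); exact he.
Qed.

Lemma continuous_on_plus {T : UniformSpace} (D : T -> Prop) (f g : T -> R) :
  continuous_on D f -> continuous_on D g ->
  continuous_on D (fun x => f x + g x).
Proof.
  intros hf hg x hx.
  exact (filterlim_comp_2 f g Rplus (hf x hx) (hg x hx)
           (filterlim_plus (V := R_NormedModule) (f x) (g x))).
Qed.

Lemma continuous_on_mult {T : UniformSpace} (D : T -> Prop) (f g : T -> R) :
  continuous_on D f -> continuous_on D g ->
  continuous_on D (fun x => f x * g x).
Proof.
  intros hf hg x hx.
  exact (filterlim_comp_2 f g Rmult (hf x hx) (hg x hx)
           (filterlim_mult (K := R_AbsRing) (f x) (g x))).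
Qed.

Lemma continuous_on_const {T : UniformSpace} (D : T -> Prop) (c : R) :
  continuous_on D (fun _ => c).
Proof. intros x _; apply filterlim_const. Qed.

(** Subtract from [f] the primitive of the clamped [df]: the difference has zero derivative inside
    the segment, so the mean value theorem makes its end values equal. *)
Lemma RInt_derive_seg (a b : R) (f df : R -> R) :
  a < b -> continuous_on (seg a b) f -> continuous_on (seg a b) df ->
  (forall x, a < x < b -> is_derive f x (df x)) ->
  RInt df a b = f b - f a.
Proof.
  intros hab hf hdf hd.
  set (l := fun y => df (clamp a b y)).
  assert (hl : forall x, continuous l x)
    by (intros x; apply continuous_comp_clamp; [lra | exact hdf]).
  assert (hG : forall x, is_derive (RInt l a) x (l x)).
  { intros x; apply (is_derive_RInt l (RInt l a) a x); [| apply hl].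
    apply filter_forall; intros y.
    apply (RInt_correct (V := R_CompleteNormedModule)).
    apply (ex_RInt_continuous (V := R_CompleteNormedModule)); intros; apply hl. }
  destruct (MVT_seg a b (fun x => f x + -1 * RInt l a x)
              (fun x => df x + -1 * l x) hab) as [c [hc he]].
  - apply continuous_on_plus; [exact hf|].
    apply continuous_on_mult; [apply continuous_on_const|].
    apply continuous_on_forall; intros x _.
    apply (ex_derive_continuous (V := R_NormedModule)); eexists; apply hG.
  - intros x hx.
    apply (is_derive_plus (V := R_NormedModule)); [now apply hd|].
    apply is_derive_scal, hG.
  (* The third occurrence is the value [l c]; it equals [df c], so the mean slope vanishes wherever
     [c] lies. *)
  - unfold l in he at 3; rewrite (clamp_id a b c hc) in he.
    rewrite RInt_point in he; change zero with 0 in he.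
    assert (hi : RInt l a b = RInt df a b).
    { apply RInt_ext; rewrite Rmin_left, Rmax_right by lra; intros x hx.
      unfold l; rewrite clamp_id; [reflexivity | unfold seg; lra]. }
    rewrite hi in he; lra.
Qed.

(** * Derivatives relative to a subset *)

Lemma is_derive_on_intro (D : R -> Prop) (f : R -> R) (x l : R) :
  D x ->
  (forall eps : posreal, exists d : posreal, forall y, D y -> Rabs (y - x) < d ->
     Rabs (f y - f x - (y - x) * l) <= eps * Rabs (y - x)) ->
  is_derive_on D f x l.
Proof.
  intros hx h; split; [apply (is_linear_scal_l (V := R_NormedModule))|].
  intros x' hx'.
  (* [filterdiff] quantifies over all limits of the filter. Since [x] lies in [D] the filter is
     proper, and [x] is its only limit. *)
  assert (hp : ProperFilter' (within D (locally x))).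
  { split; [| apply within_filter, locally_filter].
    intros [d hd]; exact (hd x (ball_center x d) hx). }
  assert (e : x = x').
  { apply (is_filter_lim_unique (K := R_AbsRing) (V := R_NormedModule)
             (F := within D (locally x))); [| exact hx'].
    intros Q hQ; now apply filter_le_within. }
  subst x'; intros eps; destruct (h eps) as [d hd].
  exists d; intros y hy hDy; exact (hd y hDy hy).
Qed.

Lemma is_derive_on_ext (D : R -> Prop) (f g : R -> R) (x l : R) :
  D x -> (forall y, D y -> f y = g y) ->
  is_derive_on D f x l -> is_derive_on D g x l.
Proof.
  intros hx he [_ h].
  apply is_derive_on_intro; [exact hx|]; intros eps.
  destruct (h x (fun Q hQ => filter_le_within D Q hQ) eps) as [d hd].
  exists d; intros y hy hyx; rewrite <- !he by assumption.
  exact (hd y hyx hy).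
Qed.

Lemma within_locally (D : R -> Prop) (x : R) (Q : R -> Prop) :
  locally x D -> within D (locally x) Q -> locally x Q.
Proof.
  intros hD hQ; generalize (filter_and _ _ hD hQ).
  apply filter_imp; intros y [h1 h2]; exact (h2 h1).
Qed.

Lemma is_derive_on_interior (D : R -> Prop) (f : R -> R) (x l : R) :
  locally x D -> is_derive_on D f x l <-> is_derive f x l.
Proof.
  intros hD; split; intros [h1 h2]; split; try exact h1; intros x' hx' eps.
  - assert (e := is_filter_lim_locally_unique (V := R_NormedModule) x x' hx').
    subst x'; apply (within_locally D); [exact hD|].
    apply h2; intros Q hQ; now apply filter_le_within.
  - apply filter_le_within.
    apply h2; intros Q hQ; apply (within_locally D); auto.
Qed.

(** [iota] returns a derivative only when it is unique; at an interior point uniqueness is that of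
    the ordinary derivative. *)
Lemma is_derive_Derive_on (D : R -> Prop) (f : R -> R) (x : R) :
  locally x D -> ex_derive_on D f x -> is_derive f x (Derive_on D f x).
Proof.
  intros hD [l hl].
  apply (is_derive_on_interior D); [exact hD|].
  refine (iota_correct (V := R_CompleteNormedModule) (is_derive_on D f x) _).
  exists l; split; [exact hl|]; intros l' hl'.
  apply (is_derive_on_interior D) in hl, hl'; try exact hD.
  now rewrite <- (is_derive_unique f x l hl), <- (is_derive_unique f x l' hl').
Qed.

(** * Integrals depending on a parameter *)

(** Around each [y], joint continuity gives a radius within which [k s x] and [k t x] are both
    [eps / 2]-close to [k t y]; compactness of the segment yields one radius for all [x]. *)
Lemma jointly_continuous_time_uniform (J : R -> Prop) (a b : R) (k : field)
  (t : R) (eps : posreal) :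
  jointly_continuous J a b k -> J t ->
  exists d : posreal, forall s x, J s -> seg a b x -> Rabs (s - t) < d ->
    Rabs (k s x - k t x) < eps.
Proof.
  intros hk ht.
  assert (h : forall y, exists d : posreal, seg a b y ->
    forall s x, J s -> seg a b x -> Rabs (s - t) < d -> Rabs (x - y) < d ->
      Rabs (k s x - k t y) < pos_div_2 eps).
  { intros y; destruct (classic (seg a b y)) as [hy | hy];
      [| exists eps; tauto].
    destruct (hk (t, y) (conj ht hy) _ (locally_ball _ (pos_div_2 eps)))
      as [d hd].
    exists d; intros _ s x hs hx h1 h2.
    exact (hd (s, x) (conj h1 h2) (conj hs hx)). }
  set (delta := fun y => proj1_sig (constructive_indefinite_description _ (h y))).
  destruct (compactness_value_1d a b delta) as [d hd].
  exists d; intros s x hs hx hst.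
  (* Compactness supplies the nearby centre [y] only under a double negation. *)
  apply NNPP; intros hn; apply (hd x hx); intros [y [hy [hxy hdy]]].
  apply hn; unfold delta in *.
  destruct (constructive_indefinite_description _ (h y)) as [e he];
    simpl in hxy, hdy.
  assert (h1 := he hy s x hs hx (Rlt_le_trans _ _ _ hst hdy) hxy).
  assert (h2 : Rabs (k t x - k t y) < pos_div_2 eps).
  { apply (he hy t x ht hx); [| exact hxy].
    rewrite Rminus_diag, Rabs_R0; apply cond_pos. }
  simpl in h1, h2; apply Rabs_lt_between in h1, h2; apply Rabs_lt_between; lra.
Qed.

Lemma jointly_continuous_space (J : R -> Prop) (a b : R) (u : field) (t : R) :
  jointly_continuous J a b u -> J t -> continuous_on (seg a b) (u t).
Proof.
  intros hu ht x hx P hP.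
  destruct (hu (t, x) (conj ht hx) P hP) as [d hd].
  exists d; intros y hy hsy.
  exact (hd (t, y) (conj (ball_center t d) hy) (conj ht hsy)).
Qed.

Lemma jointly_continuous_time (J : R -> Prop) (a b : R) (u : field) (x : R) :
  jointly_continuous J a b u -> seg a b x -> continuous_on J (fun t => u t x).
Proof.
  intros hu hx t ht P hP.
  destruct (hu (t, x) (conj ht hx) P hP) as [d hd].
  exists d; intros s hs hJs.
  exact (hd (s, x) (conj hs (ball_center x d)) (conj hJs hx)).
Qed.

(** Points strictly between [s] and [t] are interior to [J], so interior derivatives suffice even
    when [t] is an end point. The bound on [c] lets estimates near [t] be used at [c]. *)
Lemma MVT_increment (J : R -> Prop) (g dg : R -> R) (s t : R) :
  (forall r s t, J r -> J t -> r <= s <= t -> J s) ->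
  continuous_on J g ->
  (forall r, locally r J -> is_derive g r (dg r)) ->
  J s -> J t ->
  exists c, J c /\ Rabs (c - t) <= Rabs (s - t) /\ g s - g t = dg c * (s - t).
Proof.
  intros hJ hg hd hs ht.
  assert (H : forall p q, J p -> J q -> p < q ->
            exists c, seg p q c /\ g q - g p = dg c * (q - p)).
  { intros p q hp hq hpq; apply MVT_seg; [exact hpq | |].
    - eapply continuous_on_subset; [| exact hg].
      intros x hx; exact (hJ p x q hp hq hx).
    - intros x hx; apply hd.
      apply filter_imp with (2 := locally_interior p q x hx).
      intros y hy; apply (hJ p y q hp hq); lra. }
  destruct (Rtotal_order s t) as [hst | [<- | hst]].
  - destruct (H s t hs ht hst) as [c [[h1 h2] he]].
    exists c; split; [now apply (hJ s c t)|]; split; [| lra].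
    rewrite !Rabs_left1 by lra; lra.
  - exists s; split; [exact hs|]; split; [lra | ring].
  - destruct (H t s ht hs hst) as [c [[h1 h2] he]].
    exists c; split; [now apply (hJ t c s)|]; split; [| exact he].
    rewrite !Rabs_right by lra; lra.
Qed.

(** The derivative is required only at interior times, so that no one-sided
    product rule is needed. *)
Definition time_derivative (J : R -> Prop) (a b : R) (h k : field) : Prop :=
  jointly_continuous J a b h /\ jointly_continuous J a b k /\
  forall s x, locally s J -> seg a b x ->
    is_derive (fun r => h r x) s (k s x).

Lemma time_derivative_plus (J : R -> Prop) (a b : R) (h1 k1 h2 k2 : field) :
  time_derivative J a b h1 k1 -> time_derivative J a b h2 k2 ->
  time_derivative J a b (fun t x => h1 t x + h2 t x)
    (fun t x => k1 t x + k2 t x).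
Proof.
  intros [a1 [b1 c1]] [a2 [b2 c2]].
  split; [exact (continuous_on_plus _ _ _ a1 a2)|].
  split; [exact (continuous_on_plus _ _ _ b1 b2)|].
  intros s x hs hx.
  apply (is_derive_plus (V := R_NormedModule)); auto.
Qed.

(** By the mean value theorem in time, the first-order error at [x] is [(k c x - k t x) * (s - t)],
    which is small uniformly in [x] and can be integrated. *)
Lemma is_derive_on_RInt_param (J : R -> Prop) (a b : R) (h k : field) (t : R) :
  a < b ->
  (forall r s t, J r -> J t -> r <= s <= t -> J s) ->
  time_derivative J a b h k ->
  J t ->
  is_derive_on J (fun s => RInt (h s) a b) t (RInt (k t) a b).
Proof.
  intros hab hJ [hh [hk hd]] ht.
  apply is_derive_on_intro; [exact ht|]; intros eps.
  (* Integration over length [b - a] turns this tolerance back into [eps]. *)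
  assert (he : 0 < eps / (b - a))
    by (apply Rdiv_lt_0_compat; [apply cond_pos | lra]).
  destruct (jointly_continuous_time_uniform J a b k t (mkposreal _ he) hk ht)
    as [d hu].
  exists d; intros s hs hst; simpl in hu.
  assert (ih : forall r, J r -> ex_RInt (h r) a b).
  { intros r hr; apply ex_RInt_continuous_on; [lra|].
    now apply (jointly_continuous_space J). }
  assert (ik : ex_RInt (k t) a b).
  { apply ex_RInt_continuous_on; [lra|].
    now apply (jointly_continuous_space J). }
  assert (i1 := ex_RInt_minus (h s) (h t) a b (ih s hs) (ih t ht)).
  assert (i2 := ex_RInt_scal (k t) a b (s - t) ik).
  replace (RInt (h s) a b - RInt (h t) a b - (s - t) * RInt (k t) a b)
    with (RInt (fun x => minus (minus (h s x) (h t x)) (scal (s - t) (k t x))) a b).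
  2: { rewrite (RInt_minus (V := R_CompleteNormedModule)) by assumption.
       rewrite (RInt_minus (V := R_CompleteNormedModule)) by auto.
       rewrite (RInt_scal (V := R_CompleteNormedModule)) by assumption.
       reflexivity. }
  replace (eps * Rabs (s - t))
    with ((b - a) * (eps / (b - a) * Rabs (s - t))) by (field; lra).
  apply abs_RInt_le_const; [lra | now apply (ex_RInt_minus (V := R_NormedModule)) |].
  intros x hx.
  destruct (MVT_increment J (fun r => h r x) (fun r => k r x) s t hJ)
    as [c [hc [hct e]]]; auto.
  { now apply (jointly_continuous_time J a b). }
  change (Rabs (h s x - h t x - (s - t) * k t x)
            <= eps / (b - a) * Rabs (s - t)).
  rewrite e.
  replace (k c x * (s - t) - (s - t) * k t x)
    with ((k c x - k t x) * (s - t)) by ring.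
  rewrite Rabs_mult; apply Rmult_le_compat_r; [apply Rabs_pos|].
  apply Rlt_le, hu; [exact hc | exact hx | lra].
Qed.

(** * The power balance *)

Lemma is_derive_mult_R (f g : R -> R) (x df dg : R) :
  is_derive f x df -> is_derive g x dg ->
  is_derive (fun y => f y * g y) x (df * g x + f x * dg).
Proof.
  intros hf hg; exact (is_derive_mult f g x df dg hf hg Rmult_comm).
Qed.

(** At fixed [x] the density is [c u^2 / 2], with derivative [c u u' = e u']. Joint continuity is
    read off the factors [e], [u] and [dt J u]. *)
Lemma time_derivative_energy (J : R -> Prop) (a b : R) (c : R -> R)
  (e u : field) :
  (forall t x, e t x = c x * u t x) ->
  C1_time J a b u -> C1_space J a b e ->
  time_derivative J a b (fun t x => / 2 * (e t x * u t x))
    (fun t x => e t x * dt J u t x).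
Proof.
  intros he [hu [hd hdu]] [hce _].
  split; [| split].
  - apply continuous_on_mult; [apply continuous_on_const|].
    exact (continuous_on_mult _ _ _ hce hu).
  - exact (continuous_on_mult _ _ _ hce hdu).
  - intros t x ht hx.
    assert (h := is_derive_Derive_on J (fun s => u s x) t ht
                   (hd t x (locally_singleton t J ht) hx)).
    apply is_derive_ext with (fun s => / 2 * (c x * u s x * u s x)).
    { intros s; rewrite he; reflexivity. }
    replace (e t x * dt J u t x)
      with (/ 2 * (c x * dt J u t x * u t x + c x * u t x * dt J u t x))
      by (rewrite he; field).
    apply is_derive_scal.
    apply (is_derive_mult_R (fun s => c x * u s x) (fun s => u s x));
      [apply (is_derive_scal (fun s => u s x)) |]; exact h.
Qed.

Lemma is_derive_space (J : R -> Prop) (a b : R) (e : field) (t x : R) :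
  C1_space J a b e -> J t -> a < x < b ->
  is_derive (e t) x (dx a b e t x).
Proof.
  intros [_ [hd _]] ht hx.
  apply is_derive_Derive_on.
  - apply filter_imp with (2 := locally_interior a b x hx).
    unfold seg; intros; lra.
  - apply hd; [exact ht | unfold seg; lra].
Qed.

Theorem theorem9 (a b : R) (hab : a < b)
  (J : R -> Prop) (hJ : proper_interval J)
  (P : beam) (hP : positive_parameters a b P)
  (z : state) (hreg : sufficiently_smooth J a b P z)
  (hz : timoshenko_system J a b P z) :
  forall t : R, J t ->
    is_derive_on J (Hamiltonian a b P z) t
      (bracket (tr a b (fun x =>
         v P z t x * sigma_w P z t x
         + v P z t x * shear_force P z t x
         + omega P z t x * sigma_phi P z t x)))
    /\
    is_derive_on J (Hamiltonian a b P z) t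
      (bracket (fun s =>
         dot (f_boundary a b P z t s) (e_boundary a b P z t s))).
Proof.
  intros t ht.
  set (l := bracket (tr a b _)).
  (* Both claimed values are the same number, so a single derivative has to be computed. *)
  replace (bracket (fun s => dot _ _)) with l
    by (unfold l, bracket, dot; simpl; ring).
  cut (is_derive_on J (Hamiltonian a b P z) t l); [tauto|].
  destruct hreg as [h1 h2].
  unfold energy_variables, coenergy_variables in h1, h2.
  rewrite !List.Forall_cons_iff in h1, h2.
  destruct h1 as [u1 [u2 [u3 [u4 [u5 _]]]]], h2 as [e1 [e2 [e3 [e4 [e5 _]]]]].
  assert (q2 : forall t x, v P z t x = / (rho P x * area P x) * p_w z t x)
    by (intros; apply Rmult_comm).
  assert (q4 : forall t x,
             omega P z t x = / (rho P x * inertia P x) * p_phi z t x)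
    by (intros; apply Rmult_comm).
  assert (T1 := time_derivative_energy J a b (tension P) (sigma_w P z) _
                  (fun _ _ => eq_refl) u1 e1).
  assert (T2 := time_derivative_energy J a b _ _ _ q2 u2 e2).
  assert (T3 := time_derivative_energy J a b
                  (fun x => young P x * inertia P x) (sigma_phi P z) _
                  (fun _ _ => eq_refl) u3 e3).
  assert (T4 := time_derivative_energy J a b _ _ _ q4 u4 e4).
  assert (T5 := time_derivative_energy J a b
                  (fun x => area P x * kappa P x * shear P x)
                  (shear_force P z) _ (fun _ _ => eq_refl) u5 e5).
  assert (T := time_derivative_plus _ _ _ _ _ _ _ T1
                (time_derivative_plus _ _ _ _ _ _ _ T2
                (time_derivative_plus _ _ _ _ _ _ _ T3
                (time_derivative_plus _ _ _ _ _ _ _ T4 T5)))).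
  clear T1 T2 T3 T4 T5.
  match type of T with time_derivative _ _ _ ?h0 ?k0 =>
    set (h := h0) in T; set (k := k0) in T
  end.
  assert (D := is_derive_on_RInt_param J a b h k t hab (proj1 hJ) T ht).
  destruct T as [Th [Tk _]].
  (* Here [h] is the energy density and [k] the power density; the latter is integrated in space. *)
  assert (hl : RInt (k t) a b = l).
  - unfold l, bracket, tr.
    apply (RInt_derive_seg a b (fun x => v P z t x * sigma_w P z t x
             + v P z t x * shear_force P z t x
             + omega P z t x * sigma_phi P z t x)); [exact hab | | |].
    + assert (hc : forall e, C1_space J a b e -> continuous_on (seg a b) (e t))
        by (intros e [he _]; exact (jointly_continuous_space J a b e t he ht)).
      apply continuous_on_plus; [apply continuous_on_plus |];
        apply (continuous_on_mult (T := R_UniformSpace)); now apply hc.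
    + exact (jointly_continuous_space J a b _ t Tk ht).
    + intros x hx.
      assert (hs : seg a b x) by (unfold seg; lra).
      assert (hE := hz t x ht hs).
      unfold values, energy_variables, matrix_apply, timoshenko_operator,
        row_apply, coenergy_variables, op0, opp_op, Id in hE.
      cbn [map combine fold_right fst snd] in hE.
      injection hE as E1 E2 E3 E4 E5.
      (* [E4] contributes [omega N] and [E5] contributes [- N omega]; [ring] cancels them and leaves
         the three expanded product rules. *)
      replace (k t x) with
        (dx a b (v P z) t x * sigma_w P z t x
         + v P z t x * dx a b (sigma_w P z) t x
         + (dx a b (v P z) t x * shear_force P z t x
            + v P z t x * dx a b (shear_force P z) t x)
         + (dx a b (omega P z) t x * sigma_phi P z t x
            + omega P z t x * dx a b (sigma_phi P z) t x))
        by (unfold k; rewrite E1, E2, E3, E4, E5; ring).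
      assert (hd := fun e he => is_derive_space J a b e t x he ht hx).
      exact (is_derive_plus (V := R_NormedModule) _ _ x _ _
               (is_derive_plus (V := R_NormedModule) _ _ x _ _
                  (is_derive_mult_R _ _ x _ _ (hd _ e2) (hd _ e1))
                  (is_derive_mult_R _ _ x _ _ (hd _ e2) (hd _ e5)))
               (is_derive_mult_R _ _ x _ _ (hd _ e4) (hd _ e3))).
  - rewrite <- hl; refine (is_derive_on_ext J _ _ t _ ht _ D).
    intros s hs.
    assert (ih : ex_RInt (h s) a b).
    { apply ex_RInt_continuous_on; [lra|].
      exact (jointly_continuous_space J a b h s Th hs). }
    (* The factor one half stands inside each term of [h] but outside the integral in
       [Hamiltonian]. *)
    transitivity (/ 2 * RInt (fun x => scal 2 (h s x)) a b).
    + rewrite (RInt_scal (V := R_CompleteNormedModule)) by exact ih.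
      assert (half : forall r : R, r = / 2 * (2 * r)) by (intros; field).
      apply half.
    + unfold Hamiltonian; f_equal; apply RInt_ext; intros x _.
      change (scal 2 (h s x)) with (2 * h s x).
      unfold h, v, sigma_w, omega, sigma_phi, shear_force, Rdiv.
      (* With the two inverses as atoms, the identity is polynomial in them and [field] meets no
         denominator but 2. *)
      set (i1 := / (rho P x * area P x)).
      set (i2 := / (rho P x * inertia P x)).
      match goal with |- ?p = ?q => change (p = q :> R) end; field.
Qed.
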